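(* Let $I=P_1\cap P_2\cap P_3$, where $P_1,P_2,P_3$ are monomial prime ideals of $S=K[x_1,\dots,x_n]$ with $P_i\not\subset P_j$ and $G(P_i)\cap G(P_j)=\emptyset$ for all $i\ne j$, and $P_1+P_2+P_3=\mathfrak m$. Let $d_i=\operatorname{height}(P_i)$. Then $$\operatorname{sdepth}(I)\le 3+\frac{1}{d_1d_2d_3}\left[\binom{n}{4}-\sum_{i=1}^3\binom{d_i}{4}-\sum_{i=1}^3\binom{d_i}{3}(n-d_i)-\sum_{1\le i<j\le 3}\binom{d_i}{2}\binom{d_j}{2}\right].$$
   Context: $K$ is a field, $S=K[x_1,\dots,x_n]$ is the polynomial ring, with its standard $\mathbb{Z}^n$-grading, and $\mathfrak m=(x_1,\dots,x_n)$. A monomial prime ideal $P$ is an ideal generated by a subset of the variables, and $G(P)$ is that set of variables. Binomial coefficients $\binom{a}{b}$ are $0$ when $a<b$. Let $M$ be a finitely generated $\mathbb{Z}^n$-graded $S$-module. For a homogeneous $u\in M$ and a subset $Z\subset\{x_1,\dots,x_n\}$, $uK[Z]$ denotes the $K$-subspace of $M$ generated by all $uv$, $v$ a monomial in $K[Z]$; if $uK[Z]$ is a free $K[Z]$-module it is called a Stanley space of dimension $|Z|$. A Stanley decomposition of $M$ is a presentation of $M$ as a finite direct sum of $\mathbb{Z}^n$-graded $K$-vector spaces $\mathcal{D}: M=\bigoplus_{i}u_iK[Z_i]$ with each $u_iK[Z_i]$ a Stanley space; $\operatorname{sdepth}\mathcal{D}=\min_i|Z_i|$, and $\operatorname{sdepth}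 M$ is the maximum of $\operatorname{sdepth}\mathcal{D}$ over all Stanley decompositions $\mathcal{D}$ of $M$. *)

(* Defs.v *)
From mathcomp Require Import all_boot all_order all_algebra.
From mathcomp Require Import mpoly.
From mathcomp Require Import boolp classical_sets.

Set Implicit Arguments.
Unset Strict Implicit.
Unset Printing Implicit Defensive.

Import Order.TTheory GRing.Theory Num.Theory.

Local Open Scope classical_set_scope.
Local Open Scope ring_scope.

Section MonomialIdeals.

Variables (n : nat) (K : fieldType).
Local Notation S := {mpoly K[n]}.

(* The ideal generated by the variables 'X_i, i in A; in particular the
   monomial prime ideal P with G(P) = A, and the ideal m for A = setT. *)
Definition var_ideal (A : {set 'I_n}) : set S :=
  [set p | exists q : 'I_n -> S, p = \sum_(i in A) q i * 'X_i].

Definition ideal_sum (J : finType) (P : J -> set S) : set S :=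
  [set \sum_j q j | q in [set q : J -> S | forall j, P j (q j)]].

(* [idealr_closed] includes properness. *)
Definition prime_ideal (Q : set S) : Prop :=
  idealr_closed (mem Q) /\ prime_idealr_closed (mem Q).

(* Supremum of the lengths k of chains Q_0 < ... < Q_k = P of prime ideals
   (the default 0 of [supremum] is used only for an empty or unbounded set
   of lengths, which does not occur for a prime P, S being Noetherian of
   finite dimension). *)
Definition height (P : set S) : nat :=
  supremum 0%N [set k : nat | exists Q : 'I_k.+1 -> set S,
    [/\ forall i, prime_ideal (Q i),
        forall i j : 'I_k.+1, (i < j)%N -> Q i `<` Q j
      & Q ord_max = P]].

(* The homogeneous component of degree a of S, for the standard Z^n-grading. *)
Definition mpoly_deg (a : 'I_n -> int) : set S :=
  [set p | forall m, m \in msupp p -> forall i, (m i)%:Z = a i].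

End MonomialIdeals.

Section StanleyDepth.

(* V is a Z^n-graded S-module whose component of degree a is gr a; Stanley
   decompositions are defined for graded submodules M of V. *)
Variables (n : nat) (K : fieldType) (V : lmodType {mpoly K[n]}).
Variable gr : ('I_n -> int) -> set V.
Local Notation S := {mpoly K[n]}.

Definition homogeneous (u : V) : Prop := exists a, gr a u.

Definition Kspan (A : set V) : set V :=
  [set w | exists s : seq (K * V),
    (forall t, t \in s -> A t.2) /\ w = \sum_(t <- s) t.1%:MP *: t.2].

Definition monomials_in (Z : {set 'I_n}) : set 'X_{1..n} :=
  [set m | forall i, i \notin Z -> m i = 0%N].

Definition subpoly (Z : {set 'I_n}) : set S :=
  [set f | forall m, m \in msupp f -> monomials_in Z m].

Definition uKZ (u : V) (Z : {set 'I_n}) : set V :=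
  Kspan [set 'X_[m] *: u | m in monomials_in Z].

(* The last clause says that uK[Z] is a free K[Z]-module with basis u, that is,
   free and nonzero (so the zero space is not a Stanley space). *)
Definition stanley_space (u : V) (Z : {set 'I_n}) : Prop :=
  homogeneous u /\ (forall f, subpoly Z f -> f *: u = 0 -> f = 0).

Definition stanley_decomposition (M : set V) (k : nat)
    (u : 'I_k -> V) (Z : 'I_k -> {set 'I_n}) : Prop :=
  [/\ forall i, stanley_space (u i) (Z i),
      M = [set \sum_i v i |
            v in [set v : 'I_k -> V | forall i, uKZ (u i) (Z i) (v i)]]
    & forall v : 'I_k -> V, (forall i, uKZ (u i) (Z i) (v i)) ->
        \sum_i v i = 0 -> forall i, v i = 0].

(* Since #|Z i| <= n, the neutral value n matters only when k = 0 (M = 0). *)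
Definition sdepth_dec (k : nat) (Z : 'I_k -> {set 'I_n}) : nat :=
  \big[minn/n]_(i < k) #|Z i|.

(* The values are bounded by n, so the supremum is a maximum as soon as M has
   a Stanley decomposition. *)
Definition sdepth (M : set V) : nat :=
  supremum 0%N [set s : nat |
    exists (k : nat) (u : 'I_k -> V) (Z : 'I_k -> {set 'I_n}),
      stanley_decomposition M u Z /\ s = sdepth_dec Z].

End StanleyDepth.

Definition ideal_sdepth (n : nat) (K : fieldType) (I : set {mpoly K[n]}) : nat :=
  @sdepth n K {mpoly K[n]}^o (@mpoly_deg n K) I.

(* Main.v *)
Require Import Defs.
From mathcomp Require Import all_boot all_order all_algebra.
From mathcomp Require Import mpoly.
From mathcomp Require Import boolp classical_sets.
From mathcomp Require Import ring lra zify.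

(** The blocks G_1, G_2, G_3 of variables are disjoint and cover all variables,
so I = P_1 /\ P_2 /\ P_3 is generated by the squarefree monomials x_i y_j z_k
with one variable in each block.  The bracket in the statement counts the
squarefree monomials of degree 4 in I: all 4-subsets of the variables except
those meeting a single block or exactly two of them.

Take a Stanley decomposition of I.  Every component of I in Z^n-degree is at
most one-dimensional, so the decomposition partitions the monomials of I
([stanley_decomposition_monomials]).  A generator w is divisible by the monomial
u_i of the summand u_i K[Z_i] that contains it, and u_i is in I, so w = u_i up to
a scalar.  For every variable t of Z_i outside w, the monomial w t lies in the
same summand; different pairs (w, t) therefore give different products w t, and
each generator has at least s - 3 of them if s is the minimum of the |Z_i|.

Now a squarefree monomial of degree 4 in I is a product w t in exactly two ways,
since two of its variables share a block and either of them can play the role of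
t.  Exchanging those two variables is an involution of the set of all d_1 d_2 d_3
(n - 3) pairs, and it maps the pairs chosen above to pairs that are not chosen.
Hence 2 (s - 3) <= n - 3 ([ideal_sdepth_bound], for any number of blocks), and
the bracket equals d_1 d_2 d_3 (n - 3) / 2 ([mixed_quadruples_rat]).

The d_i enter as heights, so one also needs height P_A = |A| for the ideal P_A
generated by the variables in A ([height_var_ideal]).  Only |A| as an upper bound
requires work.  It is obtained from a growth argument: if Q < Q' are primes and h
lies in Q' but not in Q, then a family that is linearly independent modulo Q'
stays independent modulo Q after multiplication by the powers of h.  So each
step down in a chain of primes raises by at least one the order of growth of the
polynomials of bounded degree modulo the prime; this order is at least n - |A|
for P_A and never exceeds n. *)

Set Implicit Arguments.
Unset Strict Implicit.
Unset Printing Implicit Defensive.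

Import Order.TTheory GRing.Theory Num.Theory.

Local Open Scope classical_set_scope.
Local Open Scope ring_scope.

(** * Ideals generated by variables *)

Lemma prime_idealP n (K : fieldType) (Q : set {mpoly K[n]}) :
  prime_ideal Q <->
  [/\ Q 0, ~ Q 1, forall a u v, Q u -> Q v -> Q (a * u + v)
    & forall u v, Q (u * v) -> Q u \/ Q v].
Proof.
split=> [[[Q0 Q1 QD] Qp]|[Q0 Q1 QD Qp]].
  split; [exact: set_mem|by move=> H; move/negP: Q1; apply; exact: mem_set| |].
    by move=> a u v Qu Qv; apply/set_mem/QD; exact: mem_set.
  move=> u v /mem_set/Qp/orP[] /set_mem; tauto.
split; [split|].
- exact: mem_set.
- by apply/negP=> /set_mem.
- by move=> a u v /set_mem Qu /set_mem Qv; apply/mem_set/QD.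
- by move=> u v /set_mem/Qp[] H; apply/orP; [left|right]; exact: mem_set.
Qed.

Section VarIdeal.
Variables (n : nat) (K : fieldType).
Local Notation S := {mpoly K[n]}.
Implicit Types (A B : {set 'I_n}) (p q : S) (m : 'X_{1..n}).

Definition meets_supp A m : bool := [exists i in A, m i != 0%N].

(** The substitution of 0 for the variables in A.  Its kernel is the ideal they
generate, which gives primality and the description by monomials at once. *)
Definition kill_vars A : S -> S :=
  comp_mpoly [tuple if i \in A then 0 else 'X_i | i < n].

Lemma kill_varsX A m :
  kill_vars A 'X_[m] = if meets_supp A m then 0 else 'X_[m].
Proof.
rewrite /kill_vars comp_mpolyX; case: ifPn => [/exists_inP[i iA mi]|].
  by rewrite (bigD1 i) //= tnth_mktuple iA expr0n (negbTE mi) mul0r.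
move=> /exists_inPn mA; rewrite [RHS]mpolyXE_id; apply: eq_bigr => i _.
rewrite tnth_mktuple; case: ifPn => // /mA; rewrite negbK => /eqP ->.
by rewrite !expr0.
Qed.

Lemma mcoeff_kill_vars A p m :
  (kill_vars A p)@_m = if meets_supp A m then 0 else p@_m.
Proof.
elim/mpolyind: p => [|c m' p _ _ IH].
  by rewrite /kill_vars raddf0 mcoeff0; case: ifP.
rewrite /kill_vars raddfD /= comp_mpolyZ -!/(kill_vars _ _) kill_varsX.
rewrite !mcoeffD IH !mcoeffZ; case: (ifPn (meets_supp A m')) => hm'.
  rewrite mcoeff0 mulr0 add0r mcoeffX.
  case: eqP => [<-|_]; first by rewrite hm'.
  by rewrite mulr0 add0r.
rewrite mcoeffX; case: eqP => [<-|_]; first by rewrite (negbTE hm').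
by rewrite mulr0 !add0r.
Qed.

Lemma var_ideal0 A : var_ideal A (0 : S).
Proof. by exists (fun=> 0); rewrite big1 // => i _; rewrite mul0r. Qed.

Lemma var_idealD A p q : var_ideal A p -> var_ideal A q -> var_ideal A (p + q).
Proof.
move=> [f ->] [g ->]; exists (fun i => f i + g i).
by rewrite -big_split /=; apply: eq_bigr => i _; rewrite mulrDl.
Qed.

Lemma var_idealM A p q : var_ideal A q -> var_ideal A (p * q).
Proof.
move=> [f ->]; exists (fun i => p * f i).
by rewrite big_distrr /=; apply: eq_bigr => i _; rewrite mulrA.
Qed.

Lemma var_ideal_gen A i : i \in A -> var_ideal A ('X_i : S).
Proof.
move=> iA; exists (fun j => (j == i)%:R).
rewrite (bigD1 i) //= eqxx mul1r big1 ?addr0 // => j /andP[_ /negbTE ->].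
by rewrite mul0r.
Qed.

(** For the converse, a polynomial in the kernel has only monomials divisible by
some variable of A, because the substitution fixes all the others. *)
Lemma var_ideal_kill A p : var_ideal A p <-> kill_vars A p = 0.
Proof.
split=> [[q ->]|pA0].
  rewrite /kill_vars raddf_sum big1 //= => i iA.
  by rewrite rmorphM /= comp_mpolyXU -tnth_nth tnth_mktuple iA mulr0.
rewrite [p]mpolyE big_seq; elim/big_ind: _ => [||m pm]; first exact: var_ideal0.
  exact: var_idealD.
have: meets_supp A m.
  apply: contraT => /negbTE mA; move: (mcoeff_kill_vars A p m).
  by rewrite mA pA0 mcoeff0 => /esym/eqP; rewrite mcoeff_eq0 pm.
case/exists_inP=> i iA mi; rewrite -mul_mpolyC.
have -> : 'X_[m] = 'X_[m - U_(i)] * 'X_i :> S by rewrite -mpolyXD submK // lep1mP.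
by rewrite mulrA; apply/var_idealM/var_ideal_gen.
Qed.

Lemma var_idealP A p :
  var_ideal A p <-> {in msupp p, forall m, meets_supp A m}.
Proof.
rewrite var_ideal_kill; split=> [pA0 m pm|pA].
  apply: contraT => /negbTE mA; move: (mcoeff_kill_vars A p m).
  by rewrite mA pA0 mcoeff0 => /esym/eqP; rewrite mcoeff_eq0 pm.
apply/mpolyP=> m; rewrite mcoeff_kill_vars mcoeff0; case: ifPn => // mA.
by apply: memN_msupp_eq0; apply: contra mA => /pA.
Qed.

Lemma var_idealX A m : var_ideal A ('X_[m] : S) <-> meets_supp A m.
Proof.
rewrite var_idealP; split=> [->//|mA m']; first by rewrite msuppX mem_seq1.
by rewrite msuppX mem_seq1 => /eqP ->.
Qed.

Lemma var_idealXU A i : var_ideal A ('X_i : S) <-> i \in A.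
Proof.
rewrite var_idealX; split=> [/exists_inP[j jA]|iA].
  by rewrite mnm1E; case: (i =P j) => [->|].
by apply/exists_inP; exists i; rewrite // mnm1E eqxx.
Qed.

Lemma var_ideal_sub A B : A \subset B -> var_ideal A `<=` (var_ideal B : set S).
Proof.
move=> AB p /var_idealP pA; apply/var_idealP=> m /pA/exists_inP[i iA mi].
by apply/exists_inP; exists i; rewrite // (fintype.subsetP AB).
Qed.

Lemma var_ideal_prime A : prime_ideal (var_ideal A : set S).
Proof.
apply/prime_idealP; split.
- exact: var_ideal0.
- by move/var_ideal_kill/eqP; rewrite /kill_vars rmorph1 oner_eq0.
- by move=> a u v uA vA; apply: var_idealD => //; apply: var_idealM.
- move=> u v /var_ideal_kill/eqP; rewrite /kill_vars rmorphM mulf_eq0.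
  by case/orP=> /eqP; [left|right]; apply/var_ideal_kill.
Qed.

End VarIdeal.

(** * The height of a monomial prime *)

Section Height.
Variables (n : nat) (K : fieldType).
Local Notation S := {mpoly K[n]}.
Implicit Types (Q : set S).

Definition indep_mod Q (I : finType) (b : I -> S) : Prop :=
  forall c : I -> K, Q (\sum_i c i *: b i) -> forall i, c i = 0.

(** Modulo Q, the polynomials of degree O(N) contain N ^ r independent ones.  For
a prime Q this is a lower bound r for the Krull dimension of S / Q; a transcendence
basis of size r would do the same, but a bare family of polynomials avoids
polynomials in r auxiliary variables. *)
Definition growth_exponent Q (r : nat) : Prop :=
  exists D, forall N, exists (I : finType) (b : I -> S),
    [/\ #|I| = (N ^ r)%N, indep_mod Q b
      & forall i m, m \in msupp (b i) -> (mdeg m <= N * D)%N].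

(** In a relation modulo Q, the terms of exponent 0 in h form a relation modulo Q',
since h is in Q'; so their coefficients vanish.  What remains is divisible by h,
and h can be cancelled because Q is prime and does not contain it. *)
Lemma indep_mod_powers Q Q' (h : S) (I : finType) (b : I -> S) N :
  prime_ideal Q -> prime_ideal Q' -> Q `<=` Q' -> Q' h -> ~ Q h ->
  indep_mod Q' b ->
  indep_mod Q (fun t : 'I_N * I => h ^+ t.1 * b t.2).
Proof.
move=> /prime_idealP[_ _ _ Qp] /prime_idealP[_ _ Q'D _] QQ' Q'h Qh bQ'.
elim: N => [|N IH] c; first by move=> _ [[]].
pose c0 i := c (ord0, i); pose c1 (t : 'I_N * I) := c (lift ord0 t.1, t.2).
have pairE M (F : 'I_M * I -> S) : \sum_t F t = \sum_a \sum_i F (a, i).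
  by rewrite pair_bigA; apply: eq_bigr => -[].
have -> : \sum_t c t *: (h ^+ t.1 * b t.2) =
    \sum_i c0 i *: b i + h * \sum_t c1 t *: (h ^+ t.1 * b t.2).
  rewrite !pairE big_ord_recl; congr (_ + _).
    by apply: eq_bigr => i _; rewrite expr0 mul1r.
  rewrite big_distrr; apply: eq_bigr => a _; rewrite big_distrr.
  by apply: eq_bigr => i _; rewrite /= -scalerAr mulrA -exprS.
move=> Qs.
have c00 : forall i, c0 i = 0.
  (* subtracting the multiple of h, which is in Q', leaves the exponent 0 part *)
  apply: bQ'; have := Q'D (- (\sum_t c1 t *: (h ^+ t.1 * b t.2))) h _ Q'h (QQ' _ Qs).
  by rewrite mulNr addrCA [_ * h]mulrC addNr addr0.
have: Q (h * \sum_t c1 t *: (h ^+ t.1 * b t.2)).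
  by move: Qs; rewrite big1 ?add0r // => i _; rewrite c00 scale0r.
case/Qp=> // /IH c10 [a i]; case: (unliftP ord0 a) => [a'|] ->.
  exact: (c10 (a', i)).
exact: c00.
Qed.

Lemma mdeg_msuppM (p q : S) k l :
  (forall m, m \in msupp p -> (mdeg m <= k)%N) ->
  (forall m, m \in msupp q -> (mdeg m <= l)%N) ->
  forall m, m \in msupp (p * q) -> (mdeg m <= k + l)%N.
Proof.
move=> pk ql m /msuppM_le/allpairsP[[m1 m2] /= [/pk m1k /ql m2l ->]].
by rewrite mdegD leq_add.
Qed.

Lemma mdeg_msuppX (p : S) k :
  (forall m, m \in msupp p -> (mdeg m <= k)%N) ->
  forall N m, m \in msupp (p ^+ N) -> (mdeg m <= N * k)%N.
Proof.
move=> pk; elim=> [|N IH] m.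
  by rewrite expr0 msupp1 mem_seq1 => /eqP ->; rewrite mdeg0.
by rewrite exprS mulSn; apply: mdeg_msuppM.
Qed.

Lemma growth_exponentS Q Q' r :
  prime_ideal Q -> prime_ideal Q' -> Q `<` Q' ->
  growth_exponent Q' r -> growth_exponent Q r.+1.
Proof.
move=> Qpr Q'pr [QQ' Q'Q] [D growQ'].
have [h Q'h Qh] : exists2 h, Q' h & ~ Q h.
  apply: contrapT => nh; apply: Q'Q => h Q'h; apply: contrapT => Qh.
  by apply: nh; exists h.
exists (msize h + D)%N => N; have [I [b [cardI bQ' degb]]] := growQ' N.
exists ('I_N * I)%type, (fun t : 'I_N * I => h ^+ t.1 * b t.2); split.
- by rewrite card_prod card_ord cardI expnS.
- exact: indep_mod_powers Q'h Qh bQ'.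
- move=> [a i] m /=; rewrite mulnDr.
  apply: mdeg_msuppM => {}m; last exact: degb.
  have hd m' : m' \in msupp h -> (mdeg m' <= msize h)%N.
    by move/msize_mdeg_lt/ltnW.
  move/(mdeg_msuppX hd)/leq_trans; apply.
  by rewrite leq_mul2r ltnW ?orbT.
Qed.

Lemma growth_exponent0 Q : prime_ideal Q -> growth_exponent Q 0.
Proof.
move=> /prime_idealP[Q0 Q1 QD _]; exists 0%N => N.
exists unit, (fun=> 1); split.
- by rewrite card_unit.
- move=> c; rewrite (bigD1 tt) //= big1 ?addr0 => [|[]//] Qc [].
  apply: contrapT => /eqP c0; apply: Q1.
  have := QD (c tt)^-1%:MP _ _ Qc Q0.
  by rewrite addr0 mul_mpolyC scalerA mulVf // scale1r.
- by move=> _ m; rewrite msupp1 mem_seq1 => /eqP ->; rewrite mdeg0.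
Qed.

(** Independence modulo Q implies independence in S, where the matrix of
coefficients has at most E ^ n columns: the exponents of the monomials that occur
are all below E. *)
Lemma indep_mod_card Q (I : finType) (b : I -> S) E :
  Q 0 -> indep_mod Q b ->
  (forall i m, m \in msupp (b i) -> (mdeg m < E)%N) -> (#|I| <= E ^ n)%N.
Proof.
move=> Q0 bQ degb; pose F := {ffun 'I_n -> 'I_E}.
pose A := \matrix_(i < #|I|, j < #|{: F}|)
  (b (enum_val i))@_[multinom (enum_val j k : nat) | k < n].
have Afree : row_free A.
  apply: inj_row_free => v vA0.
  have vb0 : \sum_i v 0 (enum_rank i) *: b i = 0.
    apply/mpolyP=> m; rewrite mcoeff0 raddf_sum /=.
    have [mE|mE] := boolP [forall k, (m k < E)%N]; last first.
      apply: big1 => i _; rewrite mcoeffZ memN_msupp_eq0 ?mulr0 //.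
      apply: contra mE => /degb mE; apply/forallP=> k.
      by apply: leq_ltn_trans mE; rewrite mdegE (bigD1 k) //= leq_addr.
    pose f : F := [ffun k => Ordinal (forallP mE k)].
    have := congr1 (fun M : 'rV_ _ => M 0 (enum_rank f)) vA0.
    rewrite !mxE (reindex enum_rank) /=; last exact/onW_bij/enum_rank_bij.
    move=> vA; rewrite -[RHS]vA; apply: eq_bigr => i _.
    rewrite !mxE mcoeffZ !enum_rankK.
    congr (_ * _@__).
    by apply/mnmP=> k; rewrite mnmE ffunE.
  apply/rowP=> i; rewrite !mxE -[i]enum_valK.
  by apply: (bQ (fun i => v 0 (enum_rank i))); rewrite vb0.
have := rank_leq_col A; rewrite (eqP (Afree : \rank A == #|I|)).
by rewrite card_ffun !card_ord.
Qed.

(** N ^ (n + 1) independent polynomials of degree at most N D cannot exist for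
large N, since there are at most (N (D + 1)) ^ n monomials to write them with. *)
Lemma growth_exponent_le Q r : Q 0 -> growth_exponent Q r -> (r <= n)%N.
Proof.
move=> Q0 [D growQ]; rewrite leqNgt; apply/negP => nr.
(* the least N with N ^ (n + 1) > (N (D + 1)) ^ n *)
pose N := ((D.+1 ^ n).+1)%N; have [I [b [cardI bQ degb]]] := growQ N.
have : (#|I| <= (N * D.+1) ^ n)%N.
  apply: indep_mod_card bQ _ => // i m /degb mD.
  by apply: leq_ltn_trans mD _; rewrite ltn_mul2l /=.
rewrite cardI expnMn leqNgt => /negP; apply.
apply: leq_trans (_ : N ^ n.+1 <= _)%N; last by rewrite leq_pexp2l.
by rewrite expnSr ltn_mul2l expn_gt0 /=.
Qed.

(** By adding the missing variables one at a time, up to the maximal ideal, one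
gets a chain of n - |A| steps above P_A. *)
Lemma growth_exponent_var (A : {set 'I_n}) :
  growth_exponent (var_ideal A) (n - #|A|).
Proof.
move: {2}(n - #|A|)%N (erefl (n - #|A|)%N) => k.
elim: k A => [|k IH] A cA; rewrite cA.
  exact/growth_exponent0/var_ideal_prime.
have [j jA] : exists j, j \notin A.
  have: (0 < #|~: A|)%N by rewrite cardsCs finset.setCK card_ord; lia.
  by case/card_gt0P=> j; rewrite finset.in_setC => ?; exists j.
have cjA : (n - #|(j |: A)%SET| = k)%N by rewrite cardsU1 jA; lia.
have := IH _ cjA; rewrite cjA; apply: growth_exponentS; try exact: var_ideal_prime.
split; first by apply: var_ideal_sub; apply: finset.subsetUr.
by move/(_ 'X_j); rewrite !var_idealXU finset.setU11 (negbTE jA) => /(_ isT).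
Qed.

Lemma growth_exponent_chain k (Q : 'I_k.+1 -> set S) r :
  (forall i, prime_ideal (Q i)) ->
  (forall i j : 'I_k.+1, (i < j)%N -> Q i `<` Q j) ->
  growth_exponent (Q ord_max) r -> growth_exponent (Q ord0) (k + r).
Proof.
elim: k Q => [|k IH] Q Qpr Qlt growQ.
  by rewrite (_ : ord0 = ord_max) //; apply: val_inj.
apply: (growth_exponentS (Q' := Q (lift ord0 ord0))) => //; first exact: Qlt.
apply: (IH (fun i => Q (lift ord0 i))) => //.
- by move=> i j ij; apply: Qlt; rewrite !lift0 ltnS.
- by rewrite (_ : lift _ _ = ord_max) //; apply: val_inj.
Qed.

Lemma supremum_nat_max (E : set nat) k :
  E k -> (forall l, E l -> (l <= k)%N) -> supremum 0%N E = k.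
Proof.
move=> Ek Eub; have Esup : supremums E k.
  by split=> [l /Eub|l]; rewrite ?leEnat //; apply.
rewrite /supremum ifF; last by apply/eqP => E0; rewrite E0 in Ek.
case: xgetP => [l _ El|/(_ k)//]; exact: is_subset1_supremums El Esup.
Qed.

(** A chain of length k below P_A yields growth of exponent k + (n - |A|) at its
bottom, hence k + (n - |A|) <= n.  Adding the variables of A one at a time gives a
chain of length |A|. *)
Lemma height_var_ideal (A : {set 'I_n}) : height (var_ideal A : set S) = #|A|.
Proof.
apply: supremum_nat_max => [|k [Q [Qpr Qlt QA]]].
  pose Q (i : 'I_#|A|.+1) : set S :=
    var_ideal [set x | x \in take i (enum A)]%SET.
  exists Q; split.
  - by move=> i; apply: var_ideal_prime.
  - move=> i j ij; split.
      apply: var_ideal_sub; apply/fintype.subsetP=> x; rewrite !inE.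
      by rewrite -(take_takel _ (ltnW ij)) => /mem_take.
    have iA : (i < #|A|)%N by rewrite (leq_trans ij) // -ltnS.
    pose x := enum_val (Ordinal iA).
    have xtake l : (x \in take l (enum A)) = (i < l)%N.
      rewrite in_take ?mem_enum ?enum_valP // /x (enum_val_nth x) index_uniq //.
        by rewrite -cardE.
      exact: enum_uniq.
    by move/(_ 'X_x); rewrite /Q !var_idealXU !inE !xtake ltnn => /(_ ij).
  - rewrite /Q /= cardE take_size; congr var_ideal; apply/finset.setP=> x.
    by rewrite !inE mem_enum.
have growQ : growth_exponent (Q ord0) (k + (n - #|A|)).
  by apply: growth_exponent_chain => //; rewrite QA; apply: growth_exponent_var.
have Q00 : Q ord0 0 by case/prime_idealP: (Qpr ord0).
have := growth_exponent_le Q00 growQ.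
by have := max_card (mem A); rewrite card_ord; lia.
Qed.
End Height.

(** * Stanley decompositions and monomials *)

Section StanleyMonomials.
Variables (n : nat) (K : fieldType).
Local Notation S := {mpoly K[n]}.
Local Notation Sreg := {mpoly K[n]}^o.
Implicit Types (m : 'X_{1..n}).

Lemma homogeneous_monomial (u : S) :
  @homogeneous n K Sreg (@mpoly_deg n K) u -> u != 0 ->
  exists c m, c != 0 /\ u = c *: 'X_[m].
Proof.
move=> [a udeg] u0; exists u@_(mlead u), (mlead u).
split; first by rewrite -mcoeff_msupp mlead_supp.
apply/mpolyP=> m; rewrite mcoeffZ mcoeffX.
have [<-|/eqP mu] := eqVneq (mlead u) m; first by rewrite mulr1.
rewrite mulr0 memN_msupp_eq0 //; apply/negP => um; apply: mu.
apply/mnmP=> i; apply/eqP; rewrite -eqz_nat.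
by rewrite (udeg _ um) (udeg _ (mlead_supp u0)).
Qed.

(** The generator is nonzero because the space is free on it, and a nonzero
homogeneous element of S is a multiple of a monomial. *)
Lemma stanley_space_monomial (u : Sreg) (Z : {set 'I_n}) :
  @stanley_space n K Sreg (@mpoly_deg n K) u Z ->
  exists c m, c != 0 /\ u = c *: 'X_[m] :> S.
Proof.
move=> [uhom ufree]; apply: homogeneous_monomial => //.
apply/eqP => u0; suff /eqP : 1 = 0 :> S by rewrite oner_eq0.
apply: ufree; last by rewrite u0 scaler0.
by move=> m; rewrite msupp1 mem_seq1 => /eqP -> i; rewrite mnm0E.
Qed.

Lemma uKZ_monomial (u : Sreg) Z c e m a :
  c != 0 -> u = c *: 'X_[e] :> S -> monomials_in Z m ->
  @uKZ n K Sreg u Z (a *: 'X_[m + e] : S).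
Proof.
move=> c0 -> mZ; exists [:: (a / c, 'X_[m] *: (c *: 'X_[e] : Sreg))].
split=> [t|]; first by rewrite mem_seq1 => /eqP ->; exists m.
rewrite big_seq1 -[RHS]/((a / c)%:MP * ('X_[m] * (c *: 'X_[e])) : S).
by rewrite mul_mpolyC -scalerAr scalerA divfK // mpolyXD.
Qed.

Lemma msupp_uKZ (u : Sreg) Z c e (v : Sreg) m :
  u = c *: 'X_[e] :> S -> @uKZ n K Sreg u Z v -> m \in msupp (v : S) ->
  exists2 m', monomials_in Z m' & m = (m' + e)%MM.
Proof.
move=> -> [s [sZ ->]] /msupp_sum_le/flattenP[/= r] /mapP[t].
rewrite filter_predT => /sZ[m' m'Z <-] -> {sZ}.
rewrite -[X in msupp X]/(t.1%:MP * ('X_[m'] * (c *: 'X_[e])) : S).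
rewrite mul_mpolyC -scalerAr -mpolyXD => /msuppZ_le/msuppZ_le.
by rewrite msuppX mem_seq1 => /eqP ->; exists m'.
Qed.

Lemma uKZ0 (u : Sreg) Z : @uKZ n K Sreg u Z 0.
Proof. by exists [::]; rewrite big_nil. Qed.

(** A Stanley decomposition of I partitions the monomials of I into the translates
e i + N^(Z i): covering holds because a monomial in a sum occurs in one of the
terms, and a monomial in two summands would contradict directness. *)
Lemma stanley_decomposition_monomials (I : set S) k
    (u : 'I_k -> Sreg) (Z : 'I_k -> {set 'I_n}) :
  @stanley_decomposition n K Sreg (@mpoly_deg n K) I k u Z ->
  exists e : 'I_k -> 'X_{1..n},
  [/\ forall i, I 'X_[e i],
      forall m, I 'X_[m] ->
        exists i m', monomials_in (Z i) m' /\ m = (m' + e i)%MM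
    & forall i j m m', monomials_in (Z i) m -> monomials_in (Z j) m' ->
        (m + e i = m' + e j)%MM -> i = j].
Proof.
move=> [uZ IE uZdirect].
have [c /fin_all_exists[e ce]] :=
  fin_all_exists (fun i => stanley_space_monomial (uZ i)).
have uX i m a : monomials_in (Z i) m ->
    @uKZ n K Sreg (u i) (Z i) (a *: 'X_[m + e i] : S).
  by case: (ce i) => ci ue; apply: uKZ_monomial ci ue.
have Z0 i : monomials_in (Z i) 0%MM by move=> j _; rewrite mnm0E.
exists e; split=> [i|m|i j m m' mZ m'Z mm'].
- rewrite IE; exists (fun j => if j == i then 'X_[e i] else 0).
    move=> j; case: eqP => [->|_]; last exact: uKZ0.
    by have := uX _ _ 1 (Z0 i); rewrite scale1r add0m.
  by rewrite (bigD1 i) //= eqxx big1 ?addr0 // => j /negbTE ->.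
- rewrite IE => -[v vZ Em].
  have : m \in msupp (\sum_i v i : S) by rewrite Em msuppX mem_seq1.
  move=> /msupp_sum_le/flattenP[/= r] /mapP[i _ ->] mvi; exists i.
  have [m' m'Z ->] := msupp_uKZ (ce i).2 (vZ i) mvi.
  by exists m'.
- apply: contrapT => /eqP ij.
  (* the common monomial and its opposite, a nontrivial sum equal to 0 *)
  pose v l : Sreg :=
    if l == i then 'X_[m + e i] else if l == j then - 'X_[m + e i] else 0.
  have vZ l : @uKZ n K Sreg (u l) (Z l) (v l).
    rewrite /v; case: eqP => [->|_].
      by have := uX _ _ 1 mZ; rewrite scale1r.
    case: eqP => [->|_]; last exact: uKZ0.
    by have := uX _ _ (-1) m'Z; rewrite scaleN1r mm'.
  have := uZdirect v vZ; rewrite (bigD1 i) //= (bigD1 j) 1?eq_sym //=.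
  rewrite big1 => [|l /andP[li lj]]; last by rewrite /v (negbTE li) (negbTE lj).
  rewrite /v eqxx eq_sym (negbTE ij) eqxx addr0 addrN => /(_ erefl i).
  rewrite eqxx => /(congr1 (mcoeff (m + e i)%MM))/eqP.
  by rewrite mcoeffX mcoeff0 eqxx oner_eq0.
Qed.

End StanleyMonomials.

(** * Transversals of the blocks and the exchange involution *)

Section Sections.
Variables (n : nat) (J : finType) (beta : 'I_n -> J).
Local Notation r := #|J|.
Implicit Types (w : {ffun J -> 'I_n}) (t : 'I_n) (p : {ffun J -> 'I_n} * 'I_n).

(** The blocks of variables are the fibres of beta, so that the minimal monomial
generators of the intersection of the block ideals are indexed by the sections of
beta. *)
Definition sections : {set {ffun J -> 'I_n}} :=
  [set w : {ffun J -> 'I_n} | [forall j, beta (w j) == j]]%SET.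

Lemma sectionsK w : w \in sections -> cancel w beta.
Proof. by rewrite inE => /forallP wb j; apply/eqP. Qed.

Definition section_mnm w : 'X_{1..n} := (\sum_j U_(w j))%MM.

Lemma section_mnmE w i : w \in sections -> section_mnm w i = (i \in codom w).
Proof.
move=> ws; rewrite mnm_sumE; have [/codomP[j ->]|iw] := boolP (i \in codom w).
  rewrite (bigD1 j) //= mnm1E eqxx big1 // => j' j'j.
  by rewrite mnm1E (can_eq (sectionsK ws)) (negbTE j'j).
rewrite big1 // => j _; rewrite mnm1E; case: eqP iw => // <-.
by rewrite codom_f.
Qed.

(** Inside the block of t, exchange t with the element chosen by w; the set of
variables in w t does not change. *)
Definition swap_section p : {ffun J -> 'I_n} * 'I_n :=
  ([ffun j => if j == beta p.2 then p.2 else p.1 j], p.1 (beta p.2)).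

Definition proper_pairs : {set {ffun J -> 'I_n} * 'I_n} :=
  [set p | (p.1 \in sections) && (p.2 \notin codom p.1)]%SET.

Lemma in_proper_pairs w t :
  ((w, t) \in proper_pairs) = (w \in sections) && (t \notin codom w).
Proof. by rewrite inE. Qed.

Lemma swap_section_proper p : p \in proper_pairs -> swap_section p \in proper_pairs.
Proof.
case: p => w t; rewrite !in_proper_pairs /= => /andP[ws tw].
have wb := sectionsK ws; apply/andP; split.
  rewrite inE; apply/forallP=> j; rewrite ffunE.
  by case: (j =P beta t) => [->|_]; rewrite ?wb.
apply/negP => /codomP[j]; rewrite ffunE; case: eqP => [_ wt|jt /(congr1 beta)].
  by move: tw; rewrite -wt codom_f.
by rewrite !wb => /esym.
Qed.

Lemma swap_sectionK : {in proper_pairs, cancel swap_section swap_section}.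
Proof.
move=> [w t]; rewrite in_proper_pairs => /andP[/sectionsK wb _].
rewrite /swap_section /= wb ffunE eqxx; congr (_, _).
by apply/ffunP=> j; rewrite !ffunE; case: eqP => [->|].
Qed.

Lemma swap_section_mnm p : p.1 \in sections ->
  (section_mnm (swap_section p).1 + U_((swap_section p).2) =
   section_mnm p.1 + U_(p.2))%MM.
Proof.
case: p => w t /= ws; rewrite /section_mnm (bigD1 (beta t)) //=.
rewrite [in RHS](bigD1 (beta t)) //= ffunE eqxx.
rewrite addmC [RHS]addmC addmA [RHS]addmA [(U_(t) + _)%MM]addmC.
congr (_ + _)%MM; apply: eq_bigr => j /negbTE jt.
by rewrite ffunE jt.
Qed.

Lemma card_pairs (A B : finType) (E : {set A * B}) :
  #|E| = (\sum_a #|[set b | (a, b) \in E]%SET|)%N.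
Proof.
rewrite -sum1_card; under [RHS]eq_bigr do rewrite -sum1_card.
by rewrite pair_big_dep /=; apply: eq_bigl => -[a b]; rewrite /= inE.
Qed.

Lemma card_section_codom w : w \in sections -> #|codom w| = r.
Proof. by move/sectionsK/can_inj/card_codom ->. Qed.

Lemma card_proper_pairs : #|proper_pairs| = (#|sections| * (n - r))%N.
Proof.
rewrite card_pairs (bigID (mem sections)) /= addnC big1 ?add0n => [|w ws].
  rewrite -sum_nat_const; apply: eq_bigr => w ws.
  have -> : (n - r = #|[predC codom w]|)%N.
    have := cardC (mem (codom w)); rewrite (card_section_codom ws) card_ord.
    by move=> cw; rewrite -[in LHS]cw addKn.
  by apply: eq_card => t; rewrite inE in_proper_pairs ws inE.
by apply: eq_card0 => t; rewrite inE in_proper_pairs (negbTE ws).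
Qed.

Lemma sections_gt0 : (forall j, exists i, beta i = j) -> (0 < #|sections|)%N.
Proof.
move=> /fin_all_exists[w wb]; apply/card_gt0P; exists (finfun w).
by rewrite inE; apply/forallP=> j; rewrite ffunE wb.
Qed.

(** The exchange is an injection of the pairs (w, t) and sends E to pairs outside
E, so E has at most half of the |sections| (n - r) pairs, while it has at least s
for each section w. *)
Lemma sections_pairs_bound (E : {set {ffun J -> 'I_n} * 'I_n}) s :
  (forall j, exists i, beta i = j) ->
  E \subset proper_pairs ->
  (forall p, p \in E -> swap_section p \notin E) ->
  (forall w, w \in sections -> (s <= #|[set t | (w, t) \in E]%SET|)%N) ->
  (s.*2 <= n - r)%N.
Proof.
move=> bsurj /fintype.subsetP Eproper Eswap Es; have sgt0 := sections_gt0 bsurj.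
have Edisj : E :&: swap_section @: E = finset.set0.
  apply/finset.setP=> p; rewrite !inE; apply/andP => -[pE /imsetP[q qE pq]].
  by move: (Eswap q qE); rewrite -pq pE.
have : (#|E| + #|(swap_section @: E)%SET| <= #|proper_pairs|)%N.
  rewrite -cardsUI Edisj cards0 addn0; apply: subset_leq_card.
  apply/fintype.subsetP=> p; rewrite inE => /orP[/Eproper//|/imsetP[q qE ->]].
  exact/swap_section_proper/Eproper.
rewrite card_in_imset => [|p q /Eproper pp /Eproper qp pq]; last first.
  by rewrite -(swap_sectionK pp) pq swap_sectionK.
rewrite addnn card_proper_pairs => Ele.
rewrite -(leq_pmul2l sgt0); apply: leq_trans Ele.
rewrite -doubleMr leq_double card_pairs -sum_nat_const.
rewrite [leqRHS](bigID (mem sections)) /=.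
by apply: leq_trans (leq_addr _ _); apply: leq_sum.
Qed.

End Sections.

(** * The bound on the Stanley depth *)

Lemma sdepth_dec_le n k (Z : 'I_k -> {set 'I_n}) i :
  (sdepth_dec Z <= #|Z i|)%N.
Proof.
rewrite /sdepth_dec; have := mem_index_enum i.
elim: (index_enum _) => //= j e IH; rewrite inE big_cons => /predU1P[->|/IH iZ].
  exact: geq_minl.
by apply: leq_trans iZ; apply: geq_minr.
Qed.

Section Bound.
Variables (n : nat) (K : fieldType) (J : finType) (beta : 'I_n -> J).
Local Notation S := {mpoly K[n]}.
Local Notation Sreg := {mpoly K[n]}^o.
Let I : set S := \bigcap_j var_ideal [set i | beta i == j]%SET.

Lemma section_mnm_mem w : w \in sections beta -> I 'X_[section_mnm w].
Proof.
move=> ws j _; apply/var_idealX/exists_inP; exists (w j).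
  by rewrite inE (sectionsK ws).
by rewrite (section_mnmE _ ws) codom_f.
Qed.

(** A monomial of the ideal that divides section_mnm w involves a variable of every
block, and w j is the only one of the block j available. *)
Lemma section_mnm_min w m m' : w \in sections beta ->
  I 'X_[m] -> section_mnm w = (m' + m)%MM -> m = section_mnm w.
Proof.
move=> ws Im Ew; have wb := sectionsK ws.
have mw i : (m i <= section_mnm w i)%N by rewrite Ew mnmDE leq_addl.
apply/mnmP=> i; apply/eqP; rewrite eqn_leq mw (section_mnmE _ ws) /=.
case: (boolP (i \in codom w)) => // /codomP[j ->{i}].
have /var_idealX/exists_inP[i] := Im j Logic.I; rewrite inE => /eqP ij mi.
have := mw i; rewrite (section_mnmE _ ws).
case: (boolP (i \in codom w)) => [/codomP[j' ij']|_]; last by case: (m i) mi.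
by move: ij; rewrite ij' wb => <-; rewrite -ij' lt0n.
Qed.

(** E consists of the pairs (w, t) such that t belongs to the Z i of the summand
with generator section_mnm w.  If a pair and its exchange were both in E, the
monomial w t would lie in the two summands attached to them; these would coincide,
forcing the same w and hence the same t, whereas the exchange changes t. *)
Lemma stanley_decomposition_bound k
    (u : 'I_k -> Sreg) (Z : 'I_k -> {set 'I_n}) :
  (forall j, exists i, beta i = j) ->
  @stanley_decomposition n K Sreg (@mpoly_deg n K) I k u Z ->
  ((sdepth_dec Z).*2 <= n + #|J|)%N.
Proof.
move=> beta_surj /stanley_decomposition_monomials[e [Ie Icov Iuniq]].
pose E : {set {ffun J -> 'I_n} * 'I_n} :=
  [set p in proper_pairs beta |
    [exists i, (e i == section_mnm p.1) && (p.2 \in Z i)]]%SET.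
have EP w t : (w, t) \in E ->
    [/\ w \in sections beta, t \notin codom w
      & exists2 i, e i = section_mnm w & t \in Z i].
  rewrite inE in_proper_pairs => /andP[/andP[ws tw]].
  by move=> /existsP[i /andP[/eqP ei ti]]; split=> //; exists i.
have U_in (i : 'I_k) t : t \in Z i -> monomials_in (Z i) U_(t)%MM.
  by move=> tZ j; rewrite mnm1E; case: (t =P j) => // <- /negP.
have rn : (#|J| <= n)%N.
  have [f fb] := fin_all_exists beta_surj.
  by rewrite -[leqRHS]card_ord; apply: (leq_card f); apply: can_inj fb.
suff : ((sdepth_dec Z - #|J|).*2 <= n - #|J|)%N by lia.
apply: (@sections_pairs_bound n J beta E) => //.
- by apply/fintype.subsetP=> p; rewrite inE => /andP[].
- move=> [w t] wtE; apply/negP => sE; have [ws tw [i ei ti]] := EP _ _ wtE.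
  have [_ _ [j ej tj]] := EP _ _ sE.
  have := @swap_section_mnm n J beta (w, t) ws; rewrite /= -ei -ej => mm.
  have ij : i = j.
    apply: (Iuniq i j U_(t)%MM U_(w (beta t))%MM); [exact: U_in | exact: U_in |].
    by rewrite ![(U_(_) + _)%MM]addmC mm.
  move: mm; rewrite ij => /addmI /mnmP/(_ t); rewrite !mnm1E eqxx.
  by case: eqP => // wt; move: tw; rewrite -wt codom_f.
- move=> w ws.
  have [i [m' [m'Z Ew]]] := Icov _ (section_mnm_mem ws).
  have ei := section_mnm_min ws (Ie i) Ew.
  apply: (@leq_trans #|Z i :\: [set x in codom w]|%SET).
    rewrite cardsD; apply: leq_sub.
      exact: sdepth_dec_le.
    rewrite -(card_section_codom ws); apply: subset_leq_card.
    by apply/fintype.subsetP=> t; rewrite !inE => /andP[].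
  apply: subset_leq_card; apply/fintype.subsetP=> t.
  rewrite finset.in_setD 2!inE => /andP[tw ti].
  rewrite inE in_proper_pairs ws tw /=.
  by apply/existsP; exists i; rewrite ei eqxx.
Qed.

Lemma ideal_sdepth_bound :
  (forall j, exists i, beta i = j) -> ((ideal_sdepth I).*2 <= n + #|J|)%N.
Proof.
move=> beta_surj; rewrite /ideal_sdepth /sdepth /supremum; case: ifP => // _.
(* the default value of the supremum is 0, which satisfies the bound *)
case: xgetP => // s _ [_ slub].
suff : (s <= (n + #|J|)./2)%N by lia.
apply: slub => l [k [u [Z [/(stanley_decomposition_bound beta_surj) + ->]]]].
by rewrite leEnat; lia.
Qed.

End Bound.

(** Both sides count the 4-subsets of three disjoint blocks of sizes a, b, c that
meet all of them: such a set contains exactly two of the a b c transversals, each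
of which extends to n - 3 sets. *)
Lemma mixed_quadruples_rat a b c n : n = (a + b + c)%N ->
  'C(n, 4)%:R - ('C(a, 4)%:R + 'C(b, 4)%:R + 'C(c, 4)%:R)
  - ('C(a, 3)%:R * (n%:R - a%:R) + 'C(b, 3)%:R * (n%:R - b%:R)
     + 'C(c, 3)%:R * (n%:R - c%:R))
  - ('C(a, 2)%:R * 'C(b, 2)%:R + 'C(a, 2)%:R * 'C(c, 2)%:R
     + 'C(b, 2)%:R * 'C(c, 2)%:R)
  = a%:R * b%:R * c%:R * (n%:R - 3) / 2 :> rat.
Proof.
have bin2 m : 'C(m, 2)%:R = m%:R * (m%:R - 1) / 2 :> rat.
  elim: m => [|m IH]; first by rewrite !mul0r.
  by rewrite binS natrD IH bin1 -[in RHS]natr1; field.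
have bin3 m : 'C(m, 3)%:R = m%:R * (m%:R - 1) * (m%:R - 2) / 6 :> rat.
  elim: m => [|m IH]; first by rewrite !mul0r.
  by rewrite binS natrD IH bin2 -[in RHS]natr1; field.
have bin4 m : 'C(m, 4)%:R = m%:R * (m%:R - 1) * (m%:R - 2) * (m%:R - 3) / 24 :> rat.
  elim: m => [|m IH]; first by rewrite !mul0r.
  by rewrite binS natrD IH bin3 -[in RHS]natr1; field.
by move=> ->; rewrite !bin4 !bin3 !bin2 !natrD; field.
Qed.

Lemma ord3_neq (i : 'I_3) : exists j : 'I_3, i != j.
Proof.
by exists (if i == ord0 then ord_max else ord0); case: (i =P ord0) => [->|/eqP].
Qed.

Theorem theorem3p7 (n : nat) (K : fieldType)
  (P : 'I_3 -> set {mpoly K[n]}) (G : 'I_3 -> {set 'I_n}) (d : 'I_3 -> nat)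
  (hP : forall i, P i = var_ideal (G i))
  (hsub : forall i j, i != j -> ~ (P i `<=` P j))
  (hdisj : forall i j, i != j -> G i :&: G j = finset.set0)
  (hsum : ideal_sum P = var_ideal [set: 'I_n]%SET)
  (hd : forall i, d i = height (P i)) :
  (ideal_sdepth (\bigcap_i P i))%:R <=
    3 + 1 / (\prod_(i < 3) d i)%:R *
      ('C(n, 4)%:R
       - \sum_(i < 3) 'C(d i, 4)%:R
       - \sum_(i < 3) 'C(d i, 3)%:R * (n%:R - (d i)%:R)
       - \sum_(i < 3) \sum_(j < 3 | (i < j)%N) 'C(d i, 2)%:R * 'C(d j, 2)%:R)
  :> rat.
Proof.
have dG i : d i = #|G i| by rewrite hd hP height_var_ideal.
have d_gt0 i : (0 < d i)%N.
  rewrite dG card_gt0; apply/eqP => Gi0.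
  have [j /hsub] := ord3_neq i; rewrite !hP Gi0; apply.
  exact/var_ideal_sub/finset.sub0set.
have Gcover x : exists j, x \in G j.
  have : ideal_sum P 'X_x by rewrite hsum; apply: var_ideal_gen; rewrite inE.
  case=> q /= qP xq; have : var_ideal (\bigcup_j G j)%SET ('X_x : {mpoly K[n]}).
    rewrite -xq; apply: (big_ind (var_ideal _)) => [||j _]; first exact: var_ideal0.
      exact: var_idealD.
    apply: (@var_ideal_sub _ _ (G j)); first exact: finset.bigcup_sup.
    by rewrite -hP; apply: qP.
  by move/var_idealXU/finset.bigcupP => [j _ xj]; exists j.
have [beta betaG] := fin_all_exists Gcover.
have Gbeta j : G j = [set x | beta x == j]%SET.
  apply/finset.setP=> x; rewrite inE; apply/idP/eqP => [xj|<-//].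
  apply: contraTeq isT => /hdisj/finset.setP/(_ x).
  by rewrite finset.in_setI betaG xj finset.in_set0.
have beta_surj j : exists x, beta x = j.
  have := d_gt0 j; rewrite dG => /card_gt0P[x]; rewrite Gbeta inE => /eqP.
  by exists x.
have n_d : n = (\sum_j d j)%N.
  rewrite -[LHS]card_ord -sum1_card (partition_big beta xpredT) //=.
  apply: eq_bigr => j _; rewrite dG sum1_card.
  by apply: eq_card => x; rewrite Gbeta inE.
have IE : \bigcap_i P i = \bigcap_j var_ideal [set x | beta x == j]%SET.
  by apply: eq_bigcapr => j _; rewrite hP Gbeta.
have := ideal_sdepth_bound K beta_surj; rewrite -IE card_ord.
move: (ideal_sdepth _) => s s_le.
have s_le_rat : 2 * s%:R <= n%:R + 3 :> rat.
  by rewrite -natrM -natrD ler_nat mul2n.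
have d_neq0 j : (d j)%:R != 0 :> rat by rewrite pnatr_eq0 -lt0n.
under [X in _ - X]eq_bigr do rewrite big_mkcond /=.
move: n_d; rewrite !big_ord_recl !big_ord0 /= !addr0 !add0r addn0 addnA muln1.
move=> /mixed_quadruples_rat; rewrite !addrA => ->.
rewrite !natrM.
have simpl_frac (x y z q : rat) : x != 0 -> y != 0 -> z != 0 ->
    1 / (x * (y * z)) * (x * y * z * q / 2) = q / 2.
  by move=> x0 y0 z0; field; rewrite x0 y0 z0.
by rewrite simpl_frac //; lra.
Qed.
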